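(* Let $a,b,\alpha>0$ and let $f_{a,b,\alpha}$, $\widetilde{f}_{a,b,\alpha}$ and $F_{a,b,\alpha}$ be as defined in the context. Then: (a) $u\mapsto u\widetilde{f}'_{a,b,\alpha}(u)/\widetilde{f}_{a,b,\alpha}(u)$ is strictly decreasing on $(0,\infty)$; (b) $u\mapsto u{f}'_{a,b,\alpha}(u)/{f}_{a,b,\alpha}(u)$ is strictly decreasing on $(0,\infty)$; (c) $u\mapsto u{F}'_{a,b,\alpha}(u)/{F}_{a,b,\alpha}(u)$ is strictly decreasing on $(0,\infty)$; (d) $u\mapsto {F}'_{a,b,\alpha}(u)/{F}_{a,b,\alpha}(u)$ is strictly decreasing on $(0,\infty)$ (i.e. $F_{a,b,\alpha}$ is strictly log-concave).
   Context: $K_\nu$ denotes the modified Bessel function of the second kind, $K_{\nu}(u)=\int_0^{\infty}e^{-u\cosh t}\cosh(\nu t)\,dt$ for $u>0$. The gamma-gamma probability density function with parameters $a,b,\alpha>0$ is $f_{a,b,\alpha}:(0,\infty)\to(0,\infty)$, $$f_{a,b,\alpha}(u)=\frac{2(ab)^{\frac{a+b}{2}}u^{\frac{a+b}{2}-1}}{\Gamma(a)\Gamma(b)\alpha^{\frac{a+b}{2}}}K_{a-b}\left(2\sqrt{\frac{ab}{\alpha}u}\right).$$ Define $\widetilde{f}_{a,b,\alpha}(u)=f_{a,b,\alpha}\left(\frac{\alpha u^2}{4ab}\right)=\frac{2^{3-(a+b)}ab\,u^{a+b-2}}{\alpha\Gamma(a)\Gamma(b)}K_{a-b}(u)$ for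 $u>0$, and the cumulative distribution function $F_{a,b,\alpha}(u)=\int_0^u f_{a,b,\alpha}(t)\,dt$ for $u>0$. *)

(* Defs.v *)
From Stdlib Require Import Reals.
From Coquelicot Require Import Coquelicot.
Open Scope R_scope.

(* Euler's Gamma function, Gamma(a) = int_0^oo t^(a-1) e^(-t) dt  (a > 0),
   as an improper Riemann integral (improper at 0 when a < 1). *)
Definition Gamma (a : R) : R :=
  RInt_gen (fun t => Rpower t (a - 1) * exp (- t)) (at_right 0) (Rbar_locally p_infty).

Definition BesselK (nu u : R) : R :=
  RInt_gen (fun t => exp (- u * cosh t) * cosh (nu * t)) (at_point 0) (Rbar_locally p_infty).

Definition gg_pdf (a b alpha u : R) : R :=
  2 * Rpower (a * b) ((a + b) / 2) * Rpower u ((a + b) / 2 - 1)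
  / (Gamma a * Gamma b * Rpower alpha ((a + b) / 2))
  * BesselK (a - b) (2 * sqrt (a * b / alpha * u)).

Definition gg_pdf_tilde (a b alpha u : R) : R :=
  gg_pdf a b alpha (alpha * u ^ 2 / (4 * a * b)).

Definition gg_cdf (a b alpha u : R) : R :=
  RInt_gen (gg_pdf a b alpha) (at_right 0) (at_point u).

Definition strictly_decreasing_pos (g : R -> R) : Prop :=
  forall x y, 0 < x -> x < y -> g y < g x.

(* Main.v *)
Require Import Defs.
From Stdlib Require Import Reals Lra.
From Coquelicot Require Import Coquelicot.
Open Scope R_scope.

(** Put [J_p(u) = int_0^oo exp (- u cosh t) (cosh t)^p cosh (nu t) dt], so that [K = J_0],
    [K' = - J_1] and [K'' = J_2].  By the modified Bessel equation, the function
    [G(u) = u^2 K'(u)^2 - (u^2 + nu^2) K(u)^2] has derivative [- 2 u K(u)^2 < 0]; it tends to [0]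
    at [+oo], hence is positive, and [(u K' / K)' = - G / (u K^2)] gives that [u K' / K] is
    strictly decreasing.  Parts (a) and (b) follow since, up to constants and a monotone change of
    variable, [u f' / f] is [u K' / K].  For (c), with [h = u f' / f] decreasing, one has
    [u f(u) = int_0^u (1 + h) f > (1 + h(u)) F(u)], which is the sign of [- (u f / F)'];
    (d) follows on dividing by [u]. *)

(** * Convergence of improper integrals of dominated nonnegative functions *)

(** Since [f] is nonnegative, its integral over [[x, y]] grows with the interval, so the limit is
    the supremum over intervals in [D]; it is finite because the majorant [g] has a primitive [G]
    with increments at most [M]. Keeping [D] and the filters general covers [(0, oo)], [[0, oo)] and
    [(0, u]] at once. *)
Lemma is_RInt_gen_nonneg_dominated (D : R -> Prop) (Fa Fb : (R -> Prop) -> Prop)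
    {FFa : ProperFilter Fa} {FFb : ProperFilter Fb} (f g G : R -> R) (M : R) :
  (forall x y z, D x -> D y -> x <= z <= y -> D z) ->
  Fa D -> Fb D ->
  (forall x, D x -> Fa (fun z => z <= x)) ->
  (forall x, D x -> Fb (fun z => x <= z)) ->
  (forall x, D x -> continuous f x) ->
  (forall x, D x -> continuous g x) ->
  (forall x, D x -> is_derive G x (g x)) ->
  (forall x, D x -> 0 <= f x <= g x) ->
  (forall x y, D x -> D y -> x <= y -> G y - G x <= M) ->
  exists l, is_RInt_gen f Fa Fb l /\ l <= M /\
    forall x y, D x -> D y -> x <= y -> RInt f x y <= l.
Proof.
intros convD FaD FbD Fale Fbge cf cg dG fg GM.
assert (exf : forall x y, D x -> D y -> x <= y -> ex_RInt f x y).
{ intros x y Dx Dy xy; apply (ex_RInt_continuous (V:=R_CompleteNormedModule)); intros z Hz.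
  rewrite Rmin_left, Rmax_right in Hz by lra.
  apply cf, (convD x y); auto. }
assert (fM : forall x y, D x -> D y -> x <= y -> RInt f x y <= M).
{ intros x y Dx Dy xy.
  assert (Hg : is_RInt g x y (G y - G x)).
  { apply (is_RInt_derive G g); intros z Hz;
      rewrite Rmin_left, Rmax_right in Hz by lra;
      [apply dG | apply cg]; apply (convD x y); auto. }
  apply Rle_trans with (RInt g x y).
  - apply RInt_le; auto.
    + exists (G y - G x); exact Hg.
    + intros z Hz; apply fg, (convD x y); auto; lra.
  - rewrite (is_RInt_unique _ _ _ _ Hg); auto. }
assert (f0 : forall x y, D x -> D y -> x <= y -> 0 <= RInt f x y).
{ intros x y Dx Dy xy; apply RInt_ge_0; auto.
  intros z Hz; apply fg, (convD x y); auto; lra. }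
destruct (filter_ex D FaD) as [x0 Dx0].
set (E := fun r => exists x y, D x /\ D y /\ x <= y /\ r = RInt f x y).
destruct (completeness E) as [l [ubl lubl]].
{ exists M; intros r (x & y & Dx & Dy & xy & ->); auto. }
{ exists (RInt f x0 x0), x0, x0; repeat split; auto; lra. }
exists l.
assert (fl : forall x y, D x -> D y -> x <= y -> RInt f x y <= l).
{ intros x y Dx Dy xy; apply ubl; exists x, y; auto. }
split; [| split; [| exact fl]].
2:{ apply lubl; intros r (x & y & Dx & Dy & xy & ->); auto. }
intros P [eps HP].
assert (Hxy : exists x y, D x /\ D y /\ x <= y /\ l - eps < RInt f x y).
{ apply Classical_Prop.NNPP; intros H.
  assert (l <= l - eps); [| destruct eps; simpl in *; lra].
  apply lubl; intros r (x & y & Dx & Dy & xy & ->).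
  apply Rnot_lt_le; intros Hlt; apply H; exists x, y; auto. }
destruct Hxy as (x & y & Dx & Dy & xy & Hlt).
(* Any interval containing the near-optimal [[x, y]] adds only nonnegative pieces, so its integral
   stays between [l - eps] and [l]. *)
apply (Filter_prod _ _ _ (fun z => D z /\ z <= x) (fun z => D z /\ y <= z)).
- apply filter_and; auto.
- apply filter_and; auto.
- intros x' y' [Dx' Hx'] [Dy' Hy']; simpl.
  exists (RInt f x' y'); split.
  + apply (RInt_correct (V:=R_CompleteNormedModule)); apply exf; auto; lra.
  + apply HP.
    assert (H1 : RInt f x' y' = RInt f x' x + (RInt f x y + RInt f y y')).
    { rewrite <- (RInt_Chasles f x' x y'); [| apply exf; auto; lra | apply exf; auto; lra].
      rewrite <- (RInt_Chasles f x y y'); [| apply exf; auto; lra | apply exf; auto; lra].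
      reflexivity. }
    generalize (f0 x' x Dx' Dx Hx') (f0 y y' Dy Dy' Hy').
    assert (H2 : RInt f x' y' <= l) by (apply fl; auto; lra).
    intros H3 H4.
    apply Rabs_lt_between'; destruct eps; simpl in *; lra.
Qed.

(** * Exponential inequalities and positivity of the Gamma function *)

Lemma exp_le (x y : R) : x <= y -> exp x <= exp y.
Proof.
intros [H| ->]; [apply Rlt_le, exp_increasing; auto | lra].
Qed.

(** On [y > 0] the function [y^s exp (- y)] is largest at [y = s], where it equals [(s/e)^s <= s^s].
    All decay estimates below come from this bound, with [s] chosen to suit. *)
Lemma exp_opp_le_Rpower (s y : R) : 0 < s -> 0 < y -> exp (- y) <= Rpower (s / y) s.
Proof.
intros Hs Hy; unfold Rpower.
assert (Hq : 0 < s / y) by (apply Rdiv_lt_0_compat; auto).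
assert (H : - ln (s / y) <= y / s - 1).
{ rewrite <- ln_Rinv by auto.
  replace (/ (s / y)) with (y / s) by (field; lra).
  assert (H0 : 0 < y / s) by (apply Rdiv_lt_0_compat; auto).
  generalize (exp_ineq1_le (ln (y / s))); rewrite exp_ln by auto; lra. }
apply exp_le.
assert (H1 : s * (- ln (s / y)) <= s * (y / s - 1)) by (apply Rmult_le_compat_l; lra).
replace (s * (y / s - 1)) with (y - s) in H1 by (field; lra).
lra.
Qed.

(** From [exp (- x) >= 1 - x] one gets [exp x - 1 <= x exp x], hence
    [exp x - 1 - x <= x (exp x - 1)]. The right side is at most [x^2 exp x] for [x >= 0], and at
    most [x^2] for [x < 0]. *)
Lemma exp_sub_Taylor1_le (x : R) : 0 <= exp x - 1 - x <= x ^ 2 * exp (Rabs x).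
Proof.
generalize (exp_ineq1_le x) (exp_ineq1_le (- x)); intros H1 H2.
assert (E : exp x * exp (- x) = 1) by (rewrite <- exp_plus, Rplus_opp_r; apply exp_0).
generalize (exp_pos x) (exp_pos (- x)); intros P1 P2.
split; [lra|].
assert (H3 : exp x - 1 <= x * exp x) by nra.
assert (1 <= exp (Rabs x)) by (generalize (exp_ineq1_le (Rabs x)) (Rabs_pos x); lra).
destruct (Rle_dec 0 x) as [Hx|Hx].
- rewrite Rabs_pos_eq by auto. nra.
- assert (0 <= x ^ 2) by nra. nra.
Qed.

Lemma is_derive_Rpower_l (s x : R) : 0 < x ->
  is_derive (fun x => Rpower x s) x (s * Rpower x (s - 1)).
Proof.
intros Hx; apply is_derive_Reals, derivable_pt_lim_power; auto.
Qed.

Lemma continuous_Rpower_l (s x : R) : 0 < x -> continuous (fun x => Rpower x s) x.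
Proof.
intros Hx; apply (ex_derive_continuous (V:=R_NormedModule)); eexists; apply is_derive_Rpower_l; auto.
Qed.

Lemma Gamma_pos (a : R) : 0 < a -> 0 < Gamma a.
Proof.
intros Ha; unfold Gamma.
set (f := fun t => Rpower t (a - 1) * exp (- t)).
(* Writing [exp (- t) = e exp (- (1 + t))] and bounding the last factor by [((a+1)/(1+t))^(a+1)]
   gives [f t <= C (t/(1+t))^(a-1) / (1+t)^2]. As [1/(1+t)^2] is the derivative of [t/(1+t)], this
   majorant has an explicit primitive, and it handles both endpoints together. *)
set (C := exp 1 * Rpower (a + 1) (a + 1)).
assert (cf : forall x, 0 < x -> continuous f x).
{ intros x Hx; unfold f; apply (continuous_mult (K:=R_AbsRing)).
  - apply continuous_Rpower_l; auto.
  - apply (ex_derive_continuous (V:=R_NormedModule)); auto_derive; auto. }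
assert (fpos : forall x, 0 < f x).
{ intros x; unfold f; apply Rmult_lt_0_compat; apply exp_pos. }
assert (HC : 0 < C) by (apply Rmult_lt_0_compat; apply exp_pos).
assert (q0 : forall x, 0 < x -> 0 < x / (1 + x)) by (intros x Hx; apply Rdiv_lt_0_compat; lra).
destruct (is_RInt_gen_nonneg_dominated (fun x => 0 < x) (at_right 0) (Rbar_locally p_infty)
  f (fun t => C * (Rpower (t / (1 + t)) (a - 1) / (1 + t) ^ 2))
  (fun t => C * (Rpower (t / (1 + t)) a / a)) (C / a)) as (l & Hl & _ & Hl').
- intros x y z Hx Hy Hz; lra.
- exists (mkposreal 1 Rlt_0_1); intros; auto.
- exists 0; auto.
- intros x Hx; exists (mkposreal x Hx); intros y Hy _; apply Rabs_lt_between' in Hy; simpl in Hy; lra.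
- intros x Hx; exists x; intros; lra.
- auto.
- intros x Hx. apply (continuous_scal_r (V:=R_NormedModule) C).
  apply (continuous_mult (K:=R_AbsRing)).
  + apply (continuous_comp (fun t => t / (1 + t)) (fun t => Rpower t (a - 1))).
    * apply (ex_derive_continuous (V:=R_NormedModule)); auto_derive; lra.
    * apply continuous_Rpower_l; auto.
  + apply (ex_derive_continuous (V:=R_NormedModule)); auto_derive; apply Rgt_not_eq; nra.
- intros x Hx.
  evar_last.
  { apply is_derive_scal.
    apply (is_derive_ext (fun t => / a * Rpower (t / (1 + t)) a)).
    { intros t; apply Rmult_comm. }
    apply is_derive_scal.
    apply (is_derive_comp (fun t => Rpower t a) (fun t => t / (1 + t))).
    - apply is_derive_Rpower_l; auto.
    - auto_derive; [lra | reflexivity]. }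
  unfold scal; simpl; unfold mult; simpl. field; lra.
- intros x Hx; split; [apply Rlt_le, fpos|].
  unfold f, C.
  generalize (exp_opp_le_Rpower (a + 1) (1 + x)); intros H.
  replace (- x) with (1 + - (1 + x)) by ring; rewrite exp_plus.
  apply Rle_trans with (Rpower x (a - 1) * (exp 1 * Rpower ((a + 1) / (1 + x)) (a + 1))).
  + apply Rmult_le_compat_l; [apply Rlt_le, exp_pos|].
    apply Rmult_le_compat_l; [apply Rlt_le, exp_pos|]. apply H; lra.
  + apply Req_le. unfold Rpower.
    rewrite !ln_div by lra.
    replace ((1 + x) ^ 2) with (exp (2 * ln (1 + x))).
    2:{ replace (2 * ln (1 + x)) with (ln (1 + x) + ln (1 + x)) by ring.
        rewrite exp_plus, exp_ln by lra; ring. }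
    unfold Rdiv; rewrite <- exp_Ropp, <- !exp_plus. f_equal; ring.
- intros x y Hx Hy _.
  assert (H1 : Rpower (y / (1 + y)) a <= 1).
  { apply Rle_trans with (exp 0); [apply exp_le | rewrite exp_0; lra].
    assert (ln (y / (1 + y)) <= 0); [| nra].
    apply Rle_trans with (ln 1); [apply Rlt_le, ln_increasing; auto | rewrite ln_1; lra].
    apply Rmult_lt_reg_r with (1 + y); [lra|]. field_simplify; lra. }
  assert (H2 : 0 < Rpower (x / (1 + x)) a) by apply exp_pos.
  assert (H3 : 0 < / a) by (apply Rinv_0_lt_compat; auto).
  unfold Rdiv. assert (0 < C * / a) by (apply Rmult_lt_0_compat; auto). nra.
- rewrite (is_RInt_gen_unique _ _ Hl).
  apply Rlt_le_trans with (RInt f 1 2); [| apply Hl'; lra].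
  apply RInt_gt_0; auto; [lra|].
  intros x Hx; apply cf; lra.
Qed.

(** * Moments of the Bessel integral: convergence, derivatives, differential equation *)

Definition bessel_integrand (nu : R) (p : nat) (u t : R) : R :=
  exp (- u * cosh t) * cosh t ^ p * cosh (nu * t).

Definition bessel_moment (nu : R) (p : nat) (u : R) : R :=
  RInt_gen (bessel_integrand nu p u) (at_point 0) (Rbar_locally p_infty).

Lemma cosh_ge_1 (t : R) : 1 <= cosh t.
Proof.
unfold cosh; generalize (exp_ineq1_le t) (exp_ineq1_le (- t)); lra.
Qed.

Lemma cosh_ge_half_exp (t : R) : exp t / 2 <= cosh t.
Proof.
unfold cosh; generalize (exp_pos (- t)); lra.
Qed.

Lemma cosh_le_exp (t : R) : 0 <= t -> cosh t <= exp t.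
Proof.
intros Ht; unfold cosh; assert (exp (- t) <= exp t) by (apply exp_le; lra); lra.
Qed.

Lemma cosh_mul_le_exp (nu t : R) : 0 <= t -> cosh (nu * t) <= exp (Rabs nu * t).
Proof.
intros Ht; unfold cosh.
assert (exp (nu * t) <= exp (Rabs nu * t)).
{ apply exp_le, Rmult_le_compat_r; auto; apply Rle_abs. }
assert (exp (- (nu * t)) <= exp (Rabs nu * t)).
{ apply exp_le. rewrite <- Ropp_mult_distr_l_reverse.
  apply Rmult_le_compat_r; auto; rewrite <- Rabs_Ropp; apply Rle_abs. }
lra.
Qed.

(** The doubly exponential decay in [t] is traded for [exp (- s t)] at an arbitrary rate [s]; the
    price is the factor [(2s/u)^s], which records the dependence on [u]. *)
Lemma exp_cosh_le (s u t : R) : 0 < s -> 0 < u ->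
  exp (- u * cosh t) <= Rpower (2 * s / u) s * exp (- s * t).
Proof.
intros Hs Hu.
apply Rle_trans with (exp (- (u * (exp t / 2)))).
{ apply exp_le. generalize (cosh_ge_half_exp t); nra. }
assert (Ht := exp_pos t).
apply Rle_trans with (Rpower (s / (u * (exp t / 2))) s).
{ apply exp_opp_le_Rpower; auto. apply Rmult_lt_0_compat; lra. }
apply Req_le; unfold Rpower; rewrite <- exp_plus; f_equal.
replace (s / (u * (exp t / 2))) with (2 * s / u / exp t) by (field; lra).
assert (0 < 2 * s / u) by (apply Rdiv_lt_0_compat; lra).
rewrite ln_div, ln_exp by auto. ring.
Qed.

Lemma bessel_integrand_pos (nu u : R) (p : nat) (t : R) : 0 < bessel_integrand nu p u t.
Proof.
unfold bessel_integrand.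
assert (H := cosh_ge_1 t); assert (H' := cosh_ge_1 (nu * t)).
apply Rmult_lt_0_compat; [apply Rmult_lt_0_compat; [apply exp_pos | apply pow_lt] |]; lra.
Qed.

Lemma bessel_integrand_le (nu u s : R) (p : nat) (t : R) : 0 < s -> 0 < u -> 0 <= t ->
  bessel_integrand nu p u t <=
  Rpower (2 * s / u) s * exp (- (s - INR p - Rabs nu) * t).
Proof.
intros Hs Hu Ht; unfold bessel_integrand.
apply Rle_trans with ((Rpower (2 * s / u) s * exp (- s * t)) * exp (INR p * t) * exp (Rabs nu * t)).
- assert (Hc := cosh_ge_1 t). assert (Hn := cosh_ge_1 (nu * t)).
  apply Rmult_le_compat; [| lra | | apply cosh_mul_le_exp; auto].
  + apply Rmult_le_pos; [apply Rlt_le, exp_pos | apply pow_le; lra].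
  + apply Rmult_le_compat; [apply Rlt_le, exp_pos | apply pow_le; lra | apply exp_cosh_le; auto |].
    replace (exp (INR p * t)) with (exp t ^ p).
    * apply pow_incr; split; [lra | apply cosh_le_exp; auto].
    * rewrite <- Rpower_pow by apply exp_pos. unfold Rpower; rewrite ln_exp; auto.
- apply Req_le. rewrite !Rmult_assoc, <- !exp_plus. do 2 f_equal; ring.
Qed.

Lemma continuous_bessel_integrand (nu u : R) (p : nat) (t : R) :
  continuous (bessel_integrand nu p u) t.
Proof.
apply (ex_derive_continuous (V:=R_NormedModule)).
unfold bessel_integrand, cosh; auto_derive; auto.
Qed.

(** The integrand grows at most like [exp ((p + |nu|) t)] apart from the factor [exp (- u cosh t)],
    so any rate [s > p + |nu|] gives an integrable majorant. The exponent [s] stays free because the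
    bound serves both for large [u] and for [u] near [0]. *)
Lemma bessel_moment_spec (nu u : R) (p : nat) : 0 < u ->
  is_RInt_gen (bessel_integrand nu p u) (at_point 0) (Rbar_locally p_infty) (bessel_moment nu p u)
  /\ 0 < bessel_moment nu p u
  /\ forall s, INR p + Rabs nu < s ->
       bessel_moment nu p u <= Rpower (2 * s / u) s / (s - INR p - Rabs nu).
Proof.
intros Hu.
(* Each [s] yields its own limit [l]; uniqueness of the limit then identifies all of them with the
   moment. *)
assert (main : forall s, INR p + Rabs nu < s -> exists l,
   is_RInt_gen (bessel_integrand nu p u) (at_point 0) (Rbar_locally p_infty) l
   /\ l <= Rpower (2 * s / u) s / (s - INR p - Rabs nu) /\ 0 < l).
{ intros s Hs.
  set (d := s - INR p - Rabs nu).
  assert (Hd : 0 < d) by (unfold d; lra).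
  assert (Hs0 : 0 < s) by (generalize (pos_INR p) (Rabs_pos nu); lra).
  set (A := Rpower (2 * s / u) s).
  assert (HA : 0 < A) by apply exp_pos.
  destruct (is_RInt_gen_nonneg_dominated (fun x => 0 <= x) (at_point 0) (Rbar_locally p_infty)
    (bessel_integrand nu p u) (fun t => A * exp (- d * t)) (fun t => - (A / d * exp (- d * t)))
    (A / d)) as (l & Hl & HlM & Hl').
  - intros x y z Hx Hy Hz; lra.
  - unfold at_point; lra.
  - exists 0; intros; lra.
  - intros x Hx; unfold at_point; lra.
  - intros x Hx; exists x; intros; lra.
  - intros; apply continuous_bessel_integrand.
  - intros; apply (ex_derive_continuous (V:=R_NormedModule)); auto_derive; auto.
  - intros x Hx; auto_derive; auto; field; lra.
  - intros x Hx; split; [apply Rlt_le, bessel_integrand_pos|].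
    apply bessel_integrand_le; auto.
  - intros x y Hx Hy _.
    assert (H1 : exp (- d * x) <= 1) by (rewrite <- exp_0; apply exp_le; nra).
    assert (H2 := exp_pos (- d * y)).
    assert (0 < A / d) by (apply Rdiv_lt_0_compat; auto). nra.
  - exists l; repeat split; auto.
    apply Rlt_le_trans with (RInt (bessel_integrand nu p u) 0 1); [| apply Hl'; lra].
    apply RInt_gt_0; [lra | |].
    + intros; apply bessel_integrand_pos.
    + intros; apply continuous_bessel_integrand. }
assert (uniq : forall l,
   is_RInt_gen (bessel_integrand nu p u) (at_point 0) (Rbar_locally p_infty) l ->
   bessel_moment nu p u = l).
{ intros l Hl; exact (is_RInt_gen_unique _ _ Hl). }
split; [| split].
- destruct (main (INR p + Rabs nu + 1)) as (l & Hl & _); [lra|].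
  rewrite (uniq l Hl); auto.
- destruct (main (INR p + Rabs nu + 1)) as (l & Hl & _ & H); [lra|].
  rewrite (uniq l Hl); auto.
- intros s Hs; destruct (main s Hs) as (l & Hl & H & _); rewrite (uniq l Hl); auto.
Qed.

Lemma BesselK_moment (nu u : R) : 0 < u -> BesselK nu u = bessel_moment nu 0 u.
Proof.
intros Hu; unfold BesselK.
destruct (bessel_moment_spec nu u 0 Hu) as [H _].
apply is_RInt_gen_unique.
revert H; apply is_RInt_gen_ext, filter_forall.
intros [x y] t _; unfold bessel_integrand; simpl; ring.
Qed.

(** This is differentiation under the integral sign in quantitative form. With [c = cosh t], the
    integrand on the left carries [exp (- u c) (exp (- h c) - 1 + h c)], at most
    [h^2 c^2 exp (- u c + |h| c)]. As [|h| <= u/2], the exponential is at most [exp (- (u/2) c)],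
    and [c^2] raises the moment index by two. *)
Lemma bessel_moment_Taylor1_le (nu u h : R) (p : nat) : 0 < u -> Rabs h <= u / 2 ->
  Rabs (bessel_moment nu p (u + h) - bessel_moment nu p u + h * bessel_moment nu (S p) u)
  <= h ^ 2 * bessel_moment nu (S (S p)) (u / 2).
Proof.
intros Hu Hh.
assert (Huh : 0 < u + h) by (apply Rabs_le_between in Hh; lra).
assert (Hu2 : 0 < u / 2) by lra.
destruct (bessel_moment_spec nu (u + h) p Huh) as [I1 _].
destruct (bessel_moment_spec nu u p Hu) as [I2 _].
destruct (bessel_moment_spec nu u (S p) Hu) as [I3 _].
destruct (bessel_moment_spec nu (u / 2) (S (S p)) Hu2) as [I4 _].
assert (L := is_RInt_gen_plus _ _ _ _ (is_RInt_gen_minus _ _ _ _ I1 I2) (is_RInt_gen_scal _ h _ I3)).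
assert (R := is_RInt_gen_scal _ (h ^ 2) _ I4).
refine (RInt_gen_norm (V:=R_CompleteNormedModule) _ _ _ _ _ _ L R).
- apply (Filter_prod _ _ _ (fun x => x = 0) (fun y => 0 <= y)).
  + reflexivity.
  + exists 0; intros; lra.
  + intros x y -> Hy; auto.
- apply filter_forall; intros [x y] t _.
  unfold norm, plus, minus, opp, scal; simpl; unfold abs, mult; simpl.
  unfold bessel_integrand.
  set (c := cosh t). assert (Hc : 1 <= c) by apply cosh_ge_1.
  set (w := cosh (nu * t)). assert (Hw : 1 <= w) by apply cosh_ge_1.
  assert (Hcp : 0 < c ^ p) by (apply pow_lt; lra).
  destruct (exp_sub_Taylor1_le (- h * c)) as [T0 T1].
  assert (Hcw : 0 < c ^ p * w) by (apply Rmult_lt_0_compat; lra).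
  assert (He := exp_pos (- u * c)).
  replace (_ + _ + _) with ((c ^ p * w) * (exp (- u * c) * (exp (- h * c) - 1 - - h * c))).
  2:{ replace (- (u + h) * c) with (- u * c + - h * c) by ring. rewrite exp_plus. simpl; ring. }
  rewrite Rabs_pos_eq.
  2:{ apply Rmult_le_pos; [lra|]. apply Rmult_le_pos; lra. }
  apply Rle_trans with ((c ^ p * w) * (exp (- u * c) * ((- h * c) ^ 2 * exp (u / 2 * c)))).
  + apply Rmult_le_compat_l; [lra|]. apply Rmult_le_compat_l; [lra|].
    apply Rle_trans with (1 := T1). apply Rmult_le_compat_l; [nra|].
    apply exp_le. rewrite Rabs_mult, Rabs_Ropp, (Rabs_pos_eq c) by lra. nra.
  + apply Req_le.
    replace (- (u / 2) * c) with (- u * c + u / 2 * c) by field. rewrite exp_plus. simpl; ring.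
Qed.

Lemma is_derive_bessel_moment (nu u : R) (p : nat) : 0 < u ->
  is_derive (fun u => bessel_moment nu p u) u (- bessel_moment nu (S p) u).
Proof.
intros Hu; apply is_derive_Reals; intros eps Heps.
set (M := bessel_moment nu (S (S p)) (u / 2)).
assert (HM : 0 < M) by (apply bessel_moment_spec; lra).
(* The first bound on [|h|] admits the Taylor estimate; the second makes the error quotient [|h| M]
   at most [eps / 2], which leaves room for a strict inequality. *)
assert (Hd : 0 < Rmin (u / 2) (eps / (2 * M))).
{ apply Rmin_pos; [lra | apply Rdiv_lt_0_compat; lra]. }
exists (mkposreal _ Hd); intros h Hh0 Hh; simpl in Hh.
assert (H1 : Rabs h <= u / 2) by (generalize (Rmin_l (u / 2) (eps / (2 * M))); lra).
assert (H2 : Rabs h < eps / (2 * M)) by (generalize (Rmin_r (u / 2) (eps / (2 * M))); lra).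
assert (T := bessel_moment_Taylor1_le nu u h p Hu H1); fold M in T.
assert (Ph : 0 < Rabs h) by (apply Rabs_pos_lt; auto).
replace (_ - _) with
  ((bessel_moment nu p (u + h) - bessel_moment nu p u + h * bessel_moment nu (S p) u) / h)
  by (field; auto).
unfold Rdiv; rewrite Rabs_mult, Rabs_inv.
apply Rmult_lt_reg_r with (Rabs h); auto.
rewrite Rmult_assoc, Rinv_l, Rmult_1_r by lra.
apply Rle_lt_trans with (1 := T).
rewrite <- (pow2_abs h).
apply Rle_lt_trans with (Rabs h * (eps / 2)).
- replace (Rabs h ^ 2 * M) with (Rabs h * (Rabs h * M)) by ring.
  apply Rmult_le_compat_l; [lra|].
  replace (eps / 2) with (eps / (2 * M) * M) by (field; lra).
  apply Rmult_le_compat_r; lra.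
- nra.
Qed.

(* The corresponding combination of the integrands is the [t]-derivative of
   [- exp (- u cosh t) (u sinh t cosh (nu t) + nu sinh (nu t))], which vanishes at [0] and [+oo]. *)
Lemma bessel_moment_ode (nu u : R) : 0 < u ->
  u ^ 2 * bessel_moment nu 2 u - u * bessel_moment nu 1 u
    - (u ^ 2 + nu ^ 2) * bessel_moment nu 0 u = 0.
Proof.
intros Hu.
destruct (bessel_moment_spec nu u 0 Hu) as [I0 _].
destruct (bessel_moment_spec nu u 1 Hu) as [I1 _].
destruct (bessel_moment_spec nu u 2 Hu) as [I2 _].
assert (L := is_RInt_gen_minus _ _ _ _
  (is_RInt_gen_minus _ _ _ _ (is_RInt_gen_scal _ (u ^ 2) _ I2) (is_RInt_gen_scal _ u _ I1))
  (is_RInt_gen_scal _ (u ^ 2 + nu ^ 2) _ I0)).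
set (g := fun t => exp (- u * cosh t) * (u ^ 2 * cosh t ^ 2 - u * cosh t - (u ^ 2 + nu ^ 2)) * cosh (nu * t)).
set (Phi := fun t => - (exp (- u * cosh t) * (u * sinh t * cosh (nu * t) + nu * sinh (nu * t)))).
assert (cosh_sinh : forall t, cosh t ^ 2 = 1 + sinh t ^ 2).
{ intros t. unfold cosh, sinh. assert (E : exp t * exp (- t) = 1) by (rewrite <- exp_plus, Rplus_opp_r; apply exp_0). nra. }
assert (dPhi : forall t, is_derive Phi t (g t)).
{ intros t; unfold Phi; auto_derive; auto.
  unfold g; rewrite cosh_sinh; ring. }
assert (cg : forall t, continuous g t).
{ intros t; apply (ex_derive_continuous (V:=R_NormedModule)); unfold g, cosh; auto_derive; auto. }
assert (lim : filterlim Phi (Rbar_locally p_infty) (locally 0)).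
(* With one factor [cosh t] from bounding [sinh t], this [s] makes the decay rate [s - 1 - |nu|]
   exactly [1]. *)
{ set (s := Rabs nu + 2).
  assert (Hs : 0 < s) by (unfold s; generalize (Rabs_pos nu); lra).
  set (B := Rpower (2 * s / u) s * (u + Rabs nu)).
  assert (sinh_le : forall x, Rabs (sinh x) <= cosh x).
  { intros x; apply Rabs_le; unfold sinh, cosh; generalize (exp_pos x) (exp_pos (- x)); lra. }
  assert (le : forall t, 0 <= t -> Rabs (Phi t) <= B * exp (- t)).
  { intros t Ht. unfold Phi. rewrite Rabs_Ropp, Rabs_mult, (Rabs_pos_eq (exp _)) by apply Rlt_le, exp_pos.
    apply Rle_trans with (exp (- u * cosh t) * ((u + Rabs nu) * (cosh t * cosh (nu * t)))).
    - apply Rmult_le_compat_l; [apply Rlt_le, exp_pos|].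
      eapply Rle_trans; [apply Rabs_triang|].
      rewrite !Rabs_mult, (Rabs_pos_eq u), (Rabs_pos_eq (cosh _)) by (generalize (cosh_ge_1 (nu * t)); lra).
      generalize (sinh_le t) (sinh_le (nu * t)) (cosh_ge_1 t) (cosh_ge_1 (nu * t)) (Rabs_pos nu) (Rabs_pos (sinh t)) (Rabs_pos (sinh (nu * t))).
      intros.
      assert (Rabs (sinh t) * cosh (nu * t) <= cosh t * cosh (nu * t)) by (apply Rmult_le_compat_r; lra).
      assert (Rabs (sinh (nu * t)) <= cosh t * cosh (nu * t)) by nra.
      assert (u * (Rabs (sinh t) * cosh (nu * t)) <= u * (cosh t * cosh (nu * t))) by (apply Rmult_le_compat_l; lra).
      assert (Rabs nu * Rabs (sinh (nu * t)) <= Rabs nu * (cosh t * cosh (nu * t))) by (apply Rmult_le_compat_l; lra).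
      lra.
    - assert (H := bessel_integrand_le nu u s 1 t Hs Hu Ht). unfold bessel_integrand in H.
      replace (s - INR 1 - Rabs nu) with 1 in H by (unfold s; simpl; ring).
      replace (- (1) * t) with (- t) in H by ring.
      apply Rle_trans with ((u + Rabs nu) * (exp (- u * cosh t) * cosh t ^ 1 * cosh (nu * t))).
      + apply Req_le; ring.
      + replace (B * exp (- t)) with ((u + Rabs nu) * (Rpower (2 * s / u) s * exp (- t)))
          by (unfold B; ring).
        apply Rmult_le_compat_l; [generalize (Rabs_pos nu); lra | exact H]. }
  apply (is_lim_le_le_loc (fun t => - (B * exp (- t))) (fun t => B * exp (- t)) Phi p_infty 0).
  - exists 0; intros t Ht; apply Rabs_le_between, le; lra.
  - replace (Finite 0) with (Rbar_opp (Rbar_mult B 0)) by (simpl; f_equal; ring).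
    apply is_lim_opp, is_lim_scal_l.
    apply (is_lim_comp exp Ropp p_infty 0 m_infty); [apply is_lim_exp_m | | exists 0; intros; discriminate].
    apply (is_lim_opp (fun x => x) p_infty p_infty), is_lim_id.
  - replace (Finite 0) with (Rbar_mult B 0) by (simpl; f_equal; ring).
    apply is_lim_scal_l.
    apply (is_lim_comp exp Ropp p_infty 0 m_infty); [apply is_lim_exp_m | | exists 0; intros; discriminate].
    apply (is_lim_opp (fun x => x) p_infty p_infty), is_lim_id. }
assert (R : is_RInt_gen (Derive Phi) (at_point 0) (Rbar_locally p_infty) (0 - Phi 0)).
{ assert (HD : forall t, Derive Phi t = g t) by (intros t; apply is_derive_unique, dPhi).
  apply (is_RInt_gen_Derive Phi (Phi 0) 0).
  - apply filter_forall; intros xy x _; eexists; apply dPhi.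
  - apply filter_forall; intros xy x _.
    apply (continuous_ext g); auto.
  - intros P HP; unfold filtermap, at_point; apply locally_singleton; auto.
  - exact lim. }
assert (R' : is_RInt_gen (Derive Phi) (at_point 0) (Rbar_locally p_infty)
  (u ^ 2 * bessel_moment nu 2 u - u * bessel_moment nu 1 u
    - (u ^ 2 + nu ^ 2) * bessel_moment nu 0 u)).
{ revert L; apply is_RInt_gen_ext, filter_forall; intros xy x _.
  rewrite (is_derive_unique _ _ _ (dPhi x)).
  unfold g, bessel_integrand, minus, plus, opp, scal; simpl; unfold mult; simpl. ring. }
assert (E1 := is_RInt_gen_unique (V:=R_CompleteNormedModule) _ _ R).
assert (E2 := is_RInt_gen_unique (V:=R_CompleteNormedModule) _ _ R').
rewrite E1 in E2. rewrite <- E2. unfold Phi.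
rewrite Rmult_0_r, sinh_0; ring.
Qed.

(** * Turan inequality and monotonicity of [u K' / K] *)

Lemma is_derive_neg_strictly_decreasing_pos (g dg : R -> R) :
  (forall x, 0 < x -> is_derive g x (dg x)) -> (forall x, 0 < x -> dg x < 0) ->
  strictly_decreasing_pos g.
Proof.
intros Hd Hneg x y Hx Hxy.
destruct (MVT_cor2 g dg x y Hxy) as (c & E & Hc).
- intros z Hz; apply is_derive_Reals, Hd; lra.
- assert (dg c < 0) by (apply Hneg; lra). nra.
Qed.

(** By the recurrences for [K_nu'] and [(2 nu / u) K_nu], this equals
    [u^2 (K_(nu-1) K_(nu+1) - K_nu^2)], so its positivity is the Turan-type inequality for [K]. *)
Definition bessel_turan (nu u : R) : R :=
  u ^ 2 * bessel_moment nu 1 u ^ 2 - (u ^ 2 + nu ^ 2) * bessel_moment nu 0 u ^ 2.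

Lemma is_derive_bessel_turan (nu u : R) : 0 < u ->
  is_derive (bessel_turan nu) u (- (2 * u * bessel_moment nu 0 u ^ 2)).
Proof.
intros Hu; unfold bessel_turan.
assert (E := bessel_moment_ode nu u Hu).
assert (D0 := is_derive_bessel_moment nu u 0 Hu).
assert (D1 := is_derive_bessel_moment nu u 1 Hu).
auto_derive.
- repeat split; auto; eexists; eauto.
- rewrite (is_derive_unique (fun x : R => bessel_moment nu 0 x) _ _ D0),
    (is_derive_unique (fun x : R => bessel_moment nu 1 x) _ _ D1).
  assert (E2 : u ^ 2 * bessel_moment nu 2 u
    = u * bessel_moment nu 1 u + (u ^ 2 + nu ^ 2) * bessel_moment nu 0 u) by lra.
  (* The computed derivative differs from the target by [- 2 J_1] times the left side of the
     differential equation. *)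
  match goal with |- ?l = ?r =>
    replace l with (r - 2 * bessel_moment nu 1 u * (u ^ 2 * bessel_moment nu 2 u
     - (u * bessel_moment nu 1 u + (u ^ 2 + nu ^ 2) * bessel_moment nu 0 u))) by ring end.
  rewrite E2; ring.
Qed.

(** Decay of order [u^(-2)] is enough to send [(u^2 + nu^2) J_0^2] to [0]. It comes from the moment
    bound at [s = |nu| + 2]: since [2s/u <= 1], the exponent [s >= 2] may be lowered to [2]. *)
Lemma bessel_moment_0_le (nu u : R) : 2 * (Rabs nu + 2) <= u ->
  bessel_moment nu 0 u <= 2 * (Rabs nu + 2) ^ 2 / u ^ 2.
Proof.
set (s := Rabs nu + 2); intros Hu.
assert (Hs : 2 <= s) by (unfold s; generalize (Rabs_pos nu); lra).
destruct (bessel_moment_spec nu u 0) as (_ & _ & H); [lra|].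
specialize (H s).
replace (s - INR 0 - Rabs nu) with 2 in H by (unfold s; simpl; ring).
assert (H1 : Rpower (2 * s / u) s <= (2 * s / u) ^ 2).
{ assert (H0 : 0 < 2 * s / u) by (apply Rdiv_lt_0_compat; lra).
  rewrite <- Rpower_pow by auto. simpl INR.
  unfold Rpower; apply exp_le.
  assert (ln (2 * s / u) <= 0); [| nra].
  rewrite <- ln_1; apply ln_le; auto.
  apply Rmult_le_reg_r with u; [lra|]. field_simplify; lra. }
apply Rle_trans with (Rpower (2 * s / u) s / 2).
- apply H; unfold s; simpl; lra.
- replace (2 * s ^ 2 / u ^ 2) with ((2 * s / u) ^ 2 / 2) by (field; lra). lra.
Qed.

Lemma bessel_turan_pos (nu u : R) : 0 < u -> 0 < bessel_turan nu u.
Proof.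
intros Hu; apply Rnot_le_lt; intros Hle.
assert (decr : strictly_decreasing_pos (bessel_turan nu)).
{ apply (is_derive_neg_strictly_decreasing_pos _ (fun u => - (2 * u * bessel_moment nu 0 u ^ 2))).
  - apply is_derive_bessel_turan.
  - intros x Hx; destruct (bessel_moment_spec nu x 0 Hx) as (_ & H & _).
    assert (0 < x * bessel_moment nu 0 x ^ 2) by (apply Rmult_lt_0_compat; [|apply pow_lt]; auto).
    lra. }
assert (H1 : bessel_turan nu (u + 1) < bessel_turan nu u) by (apply decr; lra).
set (d := - bessel_turan nu (u + 1)) in *.
assert (Hd : 0 < d) by (unfold d; lra).
set (s := Rabs nu + 2).
assert (Hs : 2 <= s) by (unfold s; generalize (Rabs_pos nu); lra).
assert (Hs4 : 0 < 8 * s ^ 4 / d) by (apply Rdiv_lt_0_compat; [apply Rmult_lt_0_compat; [lra|apply pow_lt; lra] | lra]).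
(* At this point [v] the decay bound applies, [G(v) < - d] by monotonicity, and yet [G(v) >= - (v^2
   + nu^2) J_0(v)^2 >= - 8 s^4 / v^2 >= - d / v >= - d], a contradiction. *)
set (v := u + 2 + 2 * s + 8 * s ^ 4 / d).
assert (Hv : 2 * s <= v /\ u + 1 < v /\ 8 * s ^ 4 / d < v) by (unfold v; lra).
assert (Hlt : bessel_turan nu v < - d) by (unfold d; rewrite Ropp_involutive; apply decr; lra).
assert (HJ : bessel_moment nu 0 v <= 2 * s ^ 2 / v ^ 2) by (apply bessel_moment_0_le; fold s; lra).
assert (HJ0 : 0 < bessel_moment nu 0 v) by (apply bessel_moment_spec; lra).
unfold bessel_turan in Hlt.
assert (H2 : 0 <= v ^ 2 * bessel_moment nu 1 v ^ 2) by (apply Rmult_le_pos; apply pow2_ge_0).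
assert (Hnu : nu ^ 2 <= v ^ 2).
{ rewrite <- (pow2_abs nu); apply pow_incr; split; [apply Rabs_pos | unfold s in *; lra]. }
assert (Hv2 : 0 < v ^ 2) by (apply pow_lt; lra).
assert (H3 : (v ^ 2 + nu ^ 2) * bessel_moment nu 0 v ^ 2 <= (2 * v ^ 2) * (2 * s ^ 2 / v ^ 2) ^ 2).
{ apply Rmult_le_compat; [generalize (pow2_ge_0 nu); lra | apply pow2_ge_0 | lra |].
  apply pow_incr; lra. }
replace ((2 * v ^ 2) * (2 * s ^ 2 / v ^ 2) ^ 2) with (8 * s ^ 4 / d * (d / v ^ 2)) in H3
  by (field; lra).
assert (H4 : 8 * s ^ 4 / d * (d / v ^ 2) <= v * (d / v ^ 2)).
{ apply Rmult_le_compat_r; [apply Rlt_le, Rdiv_lt_0_compat |]; lra. }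
replace (v * (d / v ^ 2)) with (d / v) in H4 by (field; lra).
assert (H5 : d / v <= d).
{ apply Rmult_le_reg_r with v; [lra|]. field_simplify; [nra | lra]. }
lra.
Qed.

Lemma bessel_moment_ratio_decreasing (nu : R) :
  strictly_decreasing_pos (fun u => - (u * bessel_moment nu 1 u / bessel_moment nu 0 u)).
Proof.
apply (is_derive_neg_strictly_decreasing_pos _
  (fun u => - (bessel_turan nu u / (u * bessel_moment nu 0 u ^ 2)))).
- intros u Hu.
  assert (D0 := is_derive_bessel_moment nu u 0 Hu).
  assert (D1 := is_derive_bessel_moment nu u 1 Hu).
  assert (HJ0 : 0 < bessel_moment nu 0 u) by (apply bessel_moment_spec; lra).
  assert (E := bessel_moment_ode nu u Hu).
  auto_derive.
  + repeat split; try (eexists; eauto). lra.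
  + rewrite (is_derive_unique (fun x : R => bessel_moment nu 0 x) _ _ D0),
      (is_derive_unique (fun x : R => bessel_moment nu 1 x) _ _ D1).
    unfold bessel_turan.
    assert (E2 : bessel_moment nu 2 u
      = (u * bessel_moment nu 1 u + (u ^ 2 + nu ^ 2) * bessel_moment nu 0 u) / u ^ 2).
    { apply Rmult_eq_reg_l with (u ^ 2); [| apply Rgt_not_eq, pow_lt; auto].
      field_simplify; lra. }
    rewrite E2. field; lra.
- intros u Hu.
  assert (HJ0 : 0 < bessel_moment nu 0 u) by (apply bessel_moment_spec; lra).
  apply Ropp_lt_gt_0_contravar, Rdiv_lt_0_compat.
  + apply bessel_turan_pos; auto.
  + apply Rmult_lt_0_compat; [|apply pow_lt]; auto.
Qed.

(** * Elasticity of the primitive of a function with decreasing elasticity *)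

Section Primitive.

Variables (f h : R -> R) (B m : R).
Hypothesis m_pos : 0 < m.
Hypothesis f_pos : forall u, 0 < u -> 0 < f u.
(** With [m > 0], this makes [f] integrable at [0] and gives [F(u) = O(u^m)], which provides the
    boundary value [0] at [0+]. *)
Hypothesis f_le : forall u, 0 < u -> f u <= B * Rpower u (m - 1).
Hypothesis is_derive_f : forall u, 0 < u -> is_derive f u (f u * h u / u).
Hypothesis h_decr : strictly_decreasing_pos h.

Let F (u : R) : R := RInt_gen f (at_right 0) (at_point u).

Local Lemma continuous_f (u : R) : 0 < u -> continuous f u.
Proof.
intros Hu; apply (ex_derive_continuous (V:=R_NormedModule)); eexists; apply is_derive_f; auto.
Qed.

Local Lemma primitive_spec (u : R) : 0 < u ->
  is_RInt_gen f (at_right 0) (at_point u) (F u) /\ 0 < F u <= B / m * Rpower u m.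
Proof.
intros Hu.
assert (HB : 0 < B).
{ generalize (f_pos u Hu) (f_le u Hu) (exp_pos ((m - 1) * ln u)); unfold Rpower; nra. }
destruct (is_RInt_gen_nonneg_dominated (fun x => 0 < x <= u) (at_right 0) (at_point u)
  f (fun t => B * Rpower t (m - 1)) (fun t => B / m * Rpower t m) (B / m * Rpower u m))
  as (l & Hl & HlM & Hl').
- intros x y z Hx Hy Hz; lra.
- exists (mkposreal u Hu); intros y Hy Hy0; apply Rabs_lt_between' in Hy; simpl in Hy; lra.
- unfold at_point; lra.
- intros x [Hx _]; exists (mkposreal x Hx); intros y Hy _; apply Rabs_lt_between' in Hy; simpl in Hy; lra.
- intros x Hx; unfold at_point; lra.
- intros x Hx; apply continuous_f; lra.
- intros x Hx; apply (continuous_scal_r (V:=R_NormedModule) B), continuous_Rpower_l; lra.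
- intros x Hx; evar_last.
  + apply is_derive_scal, is_derive_Rpower_l; lra.
  + simpl; field; lra.
- intros x Hx; split; [apply Rlt_le, f_pos | apply f_le]; lra.
- intros x y Hx Hy _.
  assert (H1 : Rpower y m <= Rpower u m) by (apply Rle_Rpower_l; lra).
  assert (H2 : 0 < Rpower x m) by apply exp_pos.
  assert (H3 : 0 < B / m) by (apply Rdiv_lt_0_compat; auto). nra.
- assert (E : F u = l) by exact (is_RInt_gen_unique (V:=R_CompleteNormedModule) _ _ Hl).
  rewrite E; split; [exact Hl | split; [| exact HlM]].
  apply Rlt_le_trans with (RInt f (u / 2) u); [| apply Hl'; lra].
  apply RInt_gt_0; [lra | |]; intros x Hx; [apply f_pos | apply continuous_f]; lra.
Qed.

(** Near [u], the improper integral splits as [F u] plus an ordinary integral from [u] to [v], to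
    which the fundamental theorem of calculus applies. *)
Local Lemma is_derive_primitive (u : R) : 0 < u -> is_derive F u (f u).
Proof.
intros Hu.
assert (ex : forall v, 0 < v -> is_RInt f u v (RInt f u v)).
{ intros v Hv; apply (RInt_correct (V:=R_CompleteNormedModule)).
  apply (ex_RInt_continuous (V:=R_CompleteNormedModule)); intros z Hz; apply continuous_f.
  generalize (Rmin_pos u v Hu Hv); lra. }
apply (is_derive_ext_loc (fun v => F u + RInt f u v)).
- exists (mkposreal u Hu); intros v Hv; apply Rabs_lt_between' in Hv; simpl in Hv.
  assert (Hv0 : 0 < v) by lra.
  symmetry; apply (is_RInt_gen_unique (V:=R_CompleteNormedModule)).
  apply (is_RInt_gen_Chasles f u).
  + apply primitive_spec; auto.
  + apply is_RInt_gen_at_point, ex; auto.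
- evar_last.
  + apply (is_derive_plus (fun _ => F u) (fun v => RInt f u v)).
    * apply is_derive_const.
    * apply (is_derive_RInt f _ u); [| apply continuous_f; auto].
      exists (mkposreal u Hu); intros v Hv; apply Rabs_lt_between' in Hv; simpl in Hv.
      apply ex; lra.
  + apply plus_zero_l.
Qed.

(* [t f(t) - (1 + h(u)) F(t)] vanishes at [0+] and has derivative [f(t) (h(t) - h(u)) > 0] on [(0, u)]. *)
Local Lemma primitive_lt (u : R) : 0 < u -> (1 + h u) * F u < u * f u.
Proof.
intros Hu; apply Rnot_le_lt; intros Hle.
set (Psi := fun t => t * f t - (1 + h u) * F t).
assert (incr : forall x y, 0 < x -> x < y -> y <= u -> Psi x < Psi y).
{ intros x y Hx Hxy Hyu.
  assert (dPsi : forall t, 0 < t -> is_derive Psi t (f t * (h t - h u))).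
  { intros t Ht; unfold Psi.
    assert (Df := is_derive_f t Ht). assert (DF := is_derive_primitive t Ht).
    auto_derive.
    - repeat split; eexists; eauto.
    - rewrite (is_derive_unique (fun x : R => f x) _ _ Df), (is_derive_unique (fun x : R => F x) _ _ DF).
      field; lra. }
  destruct (MVT_cor2 Psi (fun t => f t * (h t - h u)) x y Hxy) as (c & E & Hc).
  - intros z Hz; apply is_derive_Reals, dPsi; lra.
  - assert (h u < h c) by (apply h_decr; lra).
    assert (0 < f c) by (apply f_pos; lra).
    assert (0 < f c * (h c - h u)) by (apply Rmult_lt_0_compat; lra). nra. }
assert (H1 : Psi (u / 2) < Psi u) by (apply incr; lra).
assert (H2 : Psi u <= 0) by (unfold Psi; lra).
set (d := - Psi (u / 2)).
assert (Hd : 0 < d) by (unfold d; lra).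
assert (HB : 0 < B / m).
{ generalize (primitive_spec u Hu) (exp_pos (m * ln u)); unfold Rpower; intros [_ H]; nra. }
(* The added [1] keeps [K] positive even when [1 + h u = 0]. Below, [t] is taken so small that
   [K t^m <= d]; then [Psi t > - K t^m >= - d], against [Psi t < - d]. *)
set (K := (Rabs (1 + h u) + 1) * (B / m)).
assert (HK : 0 < K) by (apply Rmult_lt_0_compat; [generalize (Rabs_pos (1 + h u)) |]; lra).
set (t := Rmin (u / 4) (Rpower (d / K) (/ m))).
assert (Ht : 0 < t) by (apply Rmin_pos; [lra | apply exp_pos]).
assert (Ht4 : t <= u / 4) by apply Rmin_l.
assert (Htm : Rpower t m <= d / K).
{ apply Rle_trans with (Rpower (Rpower (d / K) (/ m)) m).
  - apply Rle_Rpower_l; [lra | split; [auto | apply Rmin_r]].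
  - rewrite Rpower_mult, Rinv_l, Rpower_1; [lra | apply Rdiv_lt_0_compat; auto | lra]. }
assert (H3 : Psi t < - d) by (unfold d; rewrite Ropp_involutive; apply incr; lra).
destruct (primitive_spec t Ht) as [_ [F0 F1]].
assert (H4 : (1 + h u) * F t <= (Rabs (1 + h u) + 1) * F t).
{ apply Rmult_le_compat_r; [lra|]. generalize (Rle_abs (1 + h u)); lra. }
assert (H5 : (Rabs (1 + h u) + 1) * F t <= K * Rpower t m).
{ unfold K; rewrite Rmult_assoc; apply Rmult_le_compat_l; [generalize (Rabs_pos (1 + h u))|]; lra. }
assert (H6 : K * Rpower t m <= d).
{ replace d with (K * (d / K)) by (field; lra). apply Rmult_le_compat_l; lra. }
assert (H7 : 0 < t * f t) by (apply Rmult_lt_0_compat; auto).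
unfold Psi in H3; lra.
Qed.

Lemma primitive_elasticity_decreasing :
  strictly_decreasing_pos (fun u => u * Derive F u / F u).
Proof.
assert (decr : strictly_decreasing_pos (fun u => u * f u / F u)).
{ apply (is_derive_neg_strictly_decreasing_pos _
    (fun u => - (f u * (u * f u - (1 + h u) * F u) / F u ^ 2))).
  - intros u Hu.
    assert (Df := is_derive_f u Hu). assert (DF := is_derive_primitive u Hu).
    destruct (primitive_spec u Hu) as [_ [F0 _]].
    auto_derive.
    + repeat split; try (eexists; eauto); lra.
    + rewrite (is_derive_unique (fun x : R => f x) _ _ Df), (is_derive_unique (fun x : R => F x) _ _ DF).
      field; lra.
  - intros u Hu. destruct (primitive_spec u Hu) as [_ [F0 _]].
    apply Ropp_lt_gt_0_contravar, Rdiv_lt_0_compat; [| apply pow_lt; auto].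
    apply Rmult_lt_0_compat; [auto|]. generalize (primitive_lt u Hu); lra. }
intros x y Hx Hxy.
rewrite !(fun u Hu => is_derive_unique F u _ (is_derive_primitive u Hu)) by lra.
apply decr; auto.
Qed.

(** For [x < y], positivity of [f / F] gives [x f(y)/F(y) < y f(y)/F(y) < x f(x)/F(x)], and [x]
    cancels. *)
Lemma primitive_log_derivative_decreasing :
  strictly_decreasing_pos (fun u => Derive F u / F u).
Proof.
intros x y Hx Hxy.
assert (H := primitive_elasticity_decreasing x y Hx Hxy); simpl in H.
destruct (primitive_spec x Hx) as [_ [Fx _]].
assert (Hy : 0 < y) by lra.
destruct (primitive_spec y Hy) as [_ [Fy _]].
rewrite !(fun u Hu => is_derive_unique F u _ (is_derive_primitive u Hu)) in * by lra.
assert (Py : 0 < f y / F y) by (apply Rdiv_lt_0_compat; auto).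
unfold Rdiv in *; rewrite !Rmult_assoc in H.
apply Rmult_lt_reg_l with x; auto.
apply Rlt_trans with (2 := H).
apply Rmult_lt_compat_r; auto.
Qed.

End Primitive.

(** * The gamma-gamma density and its distribution function *)

Definition gg_const (a b alpha : R) : R :=
  2 * Rpower (a * b) ((a + b) / 2) / (Gamma a * Gamma b * Rpower alpha ((a + b) / 2)).

Definition gg_arg (a b alpha u : R) : R := 2 * sqrt (a * b / alpha * u).

(** Closed form of [u f' / f]: the power of [u] contributes its exponent, and the Bessel factor
    contributes [x K'(x) / K(x) = - x J_1(x) / J_0(x)] times [1/2], the elasticity of the square
    root in the argument [x]. *)
Definition gg_elasticity (a b alpha u : R) : R :=
  (a + b) / 2 - 1
  + / 2 * - (gg_arg a b alpha u * bessel_moment (a - b) 1 (gg_arg a b alpha u)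
             / bessel_moment (a - b) 0 (gg_arg a b alpha u)).

Section GammaGamma.

Variables (a b alpha : R).
Hypotheses (ha : 0 < a) (hb : 0 < b) (halpha : 0 < alpha).

Local Lemma gg_const_pos : 0 < gg_const a b alpha.
Proof.
apply Rdiv_lt_0_compat.
- apply Rmult_lt_0_compat; [lra | apply exp_pos].
- apply Rmult_lt_0_compat; [apply Rmult_lt_0_compat; apply Gamma_pos; auto | apply exp_pos].
Qed.

Local Lemma gg_rate_pos : 0 < a * b / alpha.
Proof. apply Rdiv_lt_0_compat; auto; apply Rmult_lt_0_compat; auto. Qed.

Local Lemma gg_arg_pos (u : R) : 0 < u -> 0 < gg_arg a b alpha u.
Proof.
intros Hu; apply Rmult_lt_0_compat; [lra|].
apply sqrt_lt_R0, Rmult_lt_0_compat; auto; apply gg_rate_pos.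
Qed.

Local Lemma gg_pdf_eq (u : R) : 0 < u ->
  gg_pdf a b alpha u = gg_const a b alpha * Rpower u ((a + b) / 2 - 1)
                       * bessel_moment (a - b) 0 (gg_arg a b alpha u).
Proof.
intros Hu; unfold gg_pdf; fold (gg_arg a b alpha u).
rewrite BesselK_moment by (apply gg_arg_pos; auto).
unfold gg_const, Rdiv; ring.
Qed.

Local Lemma gg_pdf_pos (u : R) : 0 < u -> 0 < gg_pdf a b alpha u.
Proof.
intros Hu; rewrite gg_pdf_eq by auto.
apply Rmult_lt_0_compat; [apply Rmult_lt_0_compat; [apply gg_const_pos | apply exp_pos] |].
apply bessel_moment_spec, gg_arg_pos; auto.
Qed.

Local Lemma is_derive_gg_pdf (u : R) : 0 < u ->
  is_derive (gg_pdf a b alpha) u (gg_pdf a b alpha u * gg_elasticity a b alpha u / u).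
Proof.
intros Hu.
apply (is_derive_ext_loc (fun u => gg_const a b alpha * (Rpower u ((a + b) / 2 - 1)
                       * bessel_moment (a - b) 0 (gg_arg a b alpha u)))).
{ exists (mkposreal u Hu); intros v Hv; apply Rabs_lt_between' in Hv; simpl in Hv.
  rewrite gg_pdf_eq by lra; symmetry; apply Rmult_assoc. }
assert (Hr := gg_rate_pos).
assert (Hru : 0 < a * b / alpha * u) by (apply Rmult_lt_0_compat; auto).
assert (Hx := gg_arg_pos u Hu).
assert (darg : is_derive (gg_arg a b alpha) u (gg_arg a b alpha u / (2 * u))).
{ unfold gg_arg.
  assert (Hs := sqrt_lt_R0 _ Hru).
  evar_last.
  - apply is_derive_scal.
    apply (is_derive_comp sqrt (fun u => a * b / alpha * u)).
    + apply is_derive_Reals, derivable_pt_lim_sqrt; auto.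
    + auto_derive; [auto | reflexivity].
  - unfold scal; simpl; unfold mult; simpl.
    apply Rmult_eq_reg_r with (sqrt (a * b / alpha * u)); [| lra].
    transitivity (a * b / alpha * 1); [field; lra |].
    transitivity (sqrt (a * b / alpha * u) * sqrt (a * b / alpha * u) / u); [| field; lra].
    rewrite sqrt_sqrt by lra. field; lra. }
evar_last.
- apply is_derive_scal, (is_derive_mult (K:=R_AbsRing)).
  + apply is_derive_Rpower_l; auto.
  + apply (is_derive_comp (bessel_moment (a - b) 0)); [| exact darg].
    apply is_derive_bessel_moment; auto.
  + intros; apply Rmult_comm.
- assert (HJ : 0 < bessel_moment (a - b) 0 (gg_arg a b alpha u)) by (apply bessel_moment_spec; auto).
  rewrite gg_pdf_eq by auto.
  assert (HP : Rpower u ((a + b) / 2 - 1) = u * Rpower u ((a + b) / 2 - 1 - 1)).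
  { rewrite <- (Rpower_1 u Hu) at 2. rewrite <- Rpower_plus. f_equal; ring. }
  rewrite HP. unfold gg_elasticity.
  unfold plus, scal; simpl; unfold mult; simpl.
  field; lra.
Qed.

Local Lemma gg_elasticity_decreasing : strictly_decreasing_pos (gg_elasticity a b alpha).
Proof.
intros x y Hx Hxy; unfold gg_elasticity.
assert (Hr := gg_rate_pos).
assert (H : gg_arg a b alpha x < gg_arg a b alpha y).
{ apply Rmult_lt_compat_l; [lra|].
  apply sqrt_lt_1_alt; split; [apply Rmult_le_pos; lra | apply Rmult_lt_compat_l; auto]. }
generalize (bessel_moment_ratio_decreasing (a - b) _ _ (gg_arg_pos x Hx) H); simpl; lra.
Qed.

(* Any exponent strictly between [|a - b|] and [a + b] would do in the bound on the Bessel function. *)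
Local Lemma gg_pdf_le : exists B m, 0 < m /\
  forall u, 0 < u -> gg_pdf a b alpha u <= B * Rpower u (m - 1).
Proof.
set (s := Rmax a b).
assert (Hs : 0 < s /\ Rabs (a - b) < s /\ s < a + b).
{ unfold s; split; [| split].
  - generalize (Rmax_l a b); lra.
  - generalize (Rmax_l a b) (Rmax_r a b); intros; apply Rabs_def1; lra.
  - apply Rmax_lub_lt; lra. }
destruct Hs as (Hs0 & Hs1 & Hs2).
assert (Hr := gg_rate_pos).
(* The Bessel factor is bounded by a constant times [x^(-s)] with [x] proportional to [sqrt u], so
   [f] is bounded by a constant times [u^((a+b)/2 - 1 - s/2)]; thus [m = (a + b - s)/2], positive
   because [s < a + b]. *)
exists (gg_const a b alpha * (exp (s * (ln s - ln (a * b / alpha) / 2)) / (s - Rabs (a - b)))),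
  ((a + b - s) / 2).
split; [lra|]; intros u Hu.
rewrite gg_pdf_eq by auto.
assert (Hx := gg_arg_pos u Hu).
destruct (bessel_moment_spec (a - b) _ 0 Hx) as (_ & _ & H).
apply Rle_trans with (gg_const a b alpha * Rpower u ((a + b) / 2 - 1) *
  (Rpower (2 * s / gg_arg a b alpha u) s / (s - INR 0 - Rabs (a - b)))).
- apply Rmult_le_compat_l; [| apply H; simpl; lra].
  apply Rmult_le_pos; apply Rlt_le; [apply gg_const_pos | apply exp_pos].
- apply Req_le; simpl INR; rewrite Rminus_0_r.
  assert (Hru : 0 < a * b / alpha * u) by (apply Rmult_lt_0_compat; auto).
  assert (Hsq := sqrt_lt_R0 _ Hru).
  assert (E : Rpower u ((a + b) / 2 - 1) * Rpower (2 * s / gg_arg a b alpha u) s =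
    exp (s * (ln s - ln (a * b / alpha) / 2)) * Rpower u ((a + b - s) / 2 - 1)).
  { unfold gg_arg.
    replace (2 * s / (2 * sqrt (a * b / alpha * u))) with (s / sqrt (a * b / alpha * u))
      by (field; lra).
    unfold Rpower; rewrite <- !exp_plus; f_equal.
    rewrite ln_div by auto.
    rewrite <- (Rpower_sqrt (a * b / alpha * u)) by auto.
    unfold Rpower; rewrite ln_exp, ln_mult by auto. field. }
  transitivity (gg_const a b alpha *
    (Rpower u ((a + b) / 2 - 1) * Rpower (2 * s / gg_arg a b alpha u) s) / (s - Rabs (a - b))).
  + field; lra.
  + rewrite E; field; lra.
Qed.

Local Lemma gg_pdf_elasticity (u : R) : 0 < u ->
  u * Derive (gg_pdf a b alpha) u / gg_pdf a b alpha u = gg_elasticity a b alpha u.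
Proof.
intros Hu; rewrite (is_derive_unique _ _ _ (is_derive_gg_pdf u Hu)).
assert (H := gg_pdf_pos u Hu); field; lra.
Qed.

(** Elasticities multiply under composition, and [alpha u^2 / (4ab)] has elasticity [2]. Part (a)
    thus reduces to the monotonicity behind part (b). *)
Local Lemma gg_pdf_tilde_elasticity (u : R) : 0 < u ->
  u * Derive (gg_pdf_tilde a b alpha) u / gg_pdf_tilde a b alpha u
  = 2 * gg_elasticity a b alpha (alpha * u ^ 2 / (4 * a * b)).
Proof.
intros Hu; unfold gg_pdf_tilde.
set (v := alpha * u ^ 2 / (4 * a * b)).
assert (Hv : 0 < v).
{ apply Rdiv_lt_0_compat; repeat apply Rmult_lt_0_compat; try lra. }
assert (D : is_derive (fun u : R => gg_pdf a b alpha (alpha * u ^ 2 / (4 * a * b))) u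
  (2 * v / u * (gg_pdf a b alpha v * gg_elasticity a b alpha v / v))).
{ apply (is_derive_comp (gg_pdf a b alpha) (fun u => alpha * u ^ 2 / (4 * a * b))).
  - apply is_derive_gg_pdf; auto.
  - unfold v; auto_derive; [repeat split; auto; repeat apply Rmult_integral_contrapositive_currified; lra | field; lra]. }
rewrite (is_derive_unique (fun u : R => gg_pdf a b alpha (alpha * u ^ 2 / (4 * a * b))) _ _ D).
assert (H := gg_pdf_pos v Hv); field; lra.
Qed.

End GammaGamma.

Theorem theorem5 (a b alpha : R) (ha : 0 < a) (hb : 0 < b) (halpha : 0 < alpha) :
  strictly_decreasing_pos
    (fun u => u * Derive (gg_pdf_tilde a b alpha) u / gg_pdf_tilde a b alpha u)
  /\ strictly_decreasing_pos
    (fun u => u * Derive (gg_pdf a b alpha) u / gg_pdf a b alpha u)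
  /\ strictly_decreasing_pos
    (fun u => u * Derive (gg_cdf a b alpha) u / gg_cdf a b alpha u)
  /\ strictly_decreasing_pos
    (fun u => Derive (gg_cdf a b alpha) u / gg_cdf a b alpha u).
Proof.
assert (decr := gg_elasticity_decreasing a b alpha ha hb halpha).
destruct (gg_pdf_le a b alpha ha hb halpha) as (B & m & Hm & HB).
assert (Hpos := gg_pdf_pos a b alpha ha hb halpha).
assert (Hder := is_derive_gg_pdf a b alpha ha hb halpha).
split; [| split; [| split]].
- intros x y Hx Hxy.
  rewrite !gg_pdf_tilde_elasticity by lra.
  assert (Hab : 0 < 4 * a * b) by (repeat apply Rmult_lt_0_compat; lra).
  apply Rmult_lt_compat_l; [lra|]; apply decr.
  + apply Rdiv_lt_0_compat; auto; apply Rmult_lt_0_compat; auto; apply pow_lt; auto.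
  + apply Rmult_lt_compat_r; [apply Rinv_0_lt_compat; auto|].
    apply Rmult_lt_compat_l; auto; nra.
- intros x y Hx Hxy.
  rewrite !gg_pdf_elasticity by lra; auto.
- exact (primitive_elasticity_decreasing _ _ B m Hm Hpos HB Hder decr).
- exact (primitive_log_derivative_decreasing _ _ B m Hm Hpos HB Hder decr).
Qed.
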